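(* Let $t\in[-1,1]$, let $\mathcal{B}_t$ be the set of all bivariate copulas $C$ with Blomqvist's beta $\beta(C)=t$, and let $\underline{B}_t=\inf\mathcal{B}_t$ and $\overline{B}_t=\sup\mathcal{B}_t$ be its pointwise infimum and supremum. Then Spearman's rho satisfies $\rho(\underline{B}_t)\leqslant\rho(C)\leqslant\rho(\overline{B}_t)$ for every $C\in\mathcal{B}_t$, where (a) $\rho(\underline{B}_t)=\dfrac{3}{16}(1+t)^3-1$, and (b) $\rho(\overline{B}_t)=1-\dfrac{3}{16}(1-t)^3$.
   Context: A bivariate copula is a function $C:[0,1]^2\to[0,1]$ with $C(u,0)=C(0,v)=0$, $C(u,1)=u$, $C(1,v)=v$, that is 2-increasing. $\mathcal{C}$ denotes the set of all bivariate copulas. Blomqvist's beta: $\beta(C)=4C\left(\tfrac12,\tfrac12\right)-1$. Concordance function: for copulas $C_1,C_2$, $\mathcal{Q}(C_1,C_2)=4\int_{[0,1]^2}C_2(u,v)\,dC_1(u,v)-1$, where $dC_1$ denotes integration with respect to the probability measure on $[0,1]^2$ with distribution function $C_1$. Spearman's rho: $\rho(C)=3\mathcal{Q}(C,\Pi)$, where $\Pi(u,v)=uv$. $\mathcal{B}_t=\{C\in\mathcal{C}:\beta(C)=t\}$; $\underline{B}_t(u,v)=\inf_{C\in\mathcal{B}_t}C(u,v)$ and $\overline{B}_t(u,v)=\sup_{C\in\mathcal{B}_t}C(u,v)$ for all $(u,v)\in[0,1]^2$. These two functions are known to be copulas. *)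

(* Defs.v *)
From HB Require Import structures.
From mathcomp Require Import all_boot all_order all_algebra.
From mathcomp Require Import all_classical all_reals all_analysis.

Set Implicit Arguments.
Unset Strict Implicit.
Unset Printing Implicit Defensive.

Import Order.TTheory GRing.Theory Num.Theory.
Import numFieldNormedType.Exports.

Local Open Scope classical_set_scope.
Local Open Scope ring_scope.

(* Functions on [0,1]^2 are represented by total functions R -> R -> R: every
   condition below quantifies over [0,1] only, and no definition reads the
   values of such a function outside of [0,1]^2. *)

Definition is_copula (R : realType) (C : R -> R -> R) : Prop :=
  [/\ forall u v : R, 0 <= u <= 1 -> 0 <= v <= 1 -> 0 <= C u v <= 1,
      forall u : R, 0 <= u <= 1 -> C u 0 = 0 /\ C u 1 = u,
      forall v : R, 0 <= v <= 1 -> C 0 v = 0 /\ C 1 v = v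
    & forall u1 u2 v1 v2 : R,
        0 <= u1 -> u1 <= u2 -> u2 <= 1 -> 0 <= v1 -> v1 <= v2 -> v2 <= 1 ->
        0 <= C u2 v2 - C u2 v1 - C u1 v2 + C u1 v1].

Definition blomqvist_beta (R : realType) (C : R -> R -> R) : R :=
  4 * C (1 / 2) (1 / 2) - 1.

(* For u = v = 1 this says that [0,1]^2 has probability 1, so that a measure on
   the plane satisfying this condition is carried by [0,1]^2. *)
Definition has_distribution_function (R : realType) (C : R -> R -> R)
    (P : probability (R * R)%type R) : Prop :=
  forall u v : R, 0 <= u <= 1 -> 0 <= v <= 1 ->
    P (`[0, u] `*` `[0, v]) = (C u v)%:E.

(* The measure dC. It exists and is unique when C is a copula; the Dirac
   measure is only a default value when C is not a distribution function. *)
Definition copula_measure (R : realType) (C : R -> R -> R) :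
    probability (R * R)%type R :=
  xget (@dirac _ (R * R)%type (0, 0) R : probability _ _)
    [set P | has_distribution_function C P].

Definition concordance (R : realType) (C1 C2 : R -> R -> R) : R :=
  4 * Rintegral (copula_measure C1) (`[0, 1] `*` `[0, 1])
        (fun x => C2 x.1 x.2) - 1.

Definition independence_copula (R : realType) (u v : R) : R := u * v.

Definition spearman_rho (R : realType) (C : R -> R -> R) : R :=
  3 * concordance C (@independence_copula R).

Definition beta_class (R : realType) (t : R) : set (R -> R -> R) :=
  [set C | is_copula C /\ blomqvist_beta C = t].

Definition beta_lower (R : realType) (t u v : R) : R :=
  inf [set C u v | C in beta_class t].

Definition beta_upper (R : realType) (t u v : R) : R :=
  sup [set C u v | C in beta_class t].

(* Main.v *)
(** Writing [(U, V)] for a pair with law [dC], Hoeffding's identity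
    [E(UV) = int int P(U > s, V > t) ds dt = int int (1 - s - t + C(s, t)) ds dt]
    gives [rho(C) = 12 (int int C) - 3], so [rho] is monotone in [C].  The
    bounds of the class are the copulas
    [max(0, u + v - 1, d - (1/2 - u)^+ - (1/2 - v)^+)] with [d = C(1/2, 1/2)],
    and its image under the reflection [C(u, v) |-> u - C(u, 1 - v)], which
    reverses the order and maps [d] to [1/2 - d].  Integrating in [v] first
    gives [int int = 1/6 + d^3] for the lower bound.

    The measure [dC] is the Caratheodory extension of [C]-volume on half-open
    rectangles.  This volume is the limit of the discrete measures carried by
    finer and finer grids, hence additive, and it is countably subadditive by
    compactness since [C] is Lipschitz. *)

Require Import Defs.
From HB Require Import structures.
From mathcomp Require Import all_boot all_order all_algebra finmap.
From mathcomp Require Import all_classical all_reals all_analysis.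
From mathcomp Require Import measurable_realfun.
From mathcomp Require Import ring lra.
Import Order.TTheory GRing.Theory Num.Theory.
Import numFieldNormedType.Exports.
Local Open Scope classical_set_scope.
Local Open Scope ring_scope.

Set Implicit Arguments.
Unset Strict Implicit.
Unset Printing Implicit Defensive.

(** * Rectangles as a semiring of sets *)

Section product_semiring.
Context d1 d2 (T1 : semiRingOfSetsType d1) (T2 : semiRingOfSetsType d2).

(** An alias that keeps the semiring of rectangles apart from the product sigma-algebra on
    [T1 * T2]. *)
Definition rect_type : Type := (T1 * T2)%type.

Definition rect : set (set rect_type) :=
  [set A.1 `*` A.2 | A in [set A : set T1 * set T2 |
                            measurable A.1 /\ measurable A.2]].

Lemma is_rect (A : set T1) (B : set T2) :
  measurable A -> measurable B -> rect (A `*` B).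
Proof. by move=> mA mB; exists (A, B). Qed.

Lemma rect0 : rect set0.
Proof. by exists (set0, set0); rewrite /= ?setX0//; split; exact: measurable0. Qed.

Lemma rectI : setI_closed rect.
Proof.
move=> _ _ [[A B] [/= mA mB] <-] [[C D] [/= mC mD] <-].
by rewrite -setXI; apply: is_rect; exact: measurableI.
Qed.

(* [(A x B) \ (C x D)] is the disjoint union of [(A \ C) x B] and
   [(A & C) x (B \ D)]. *)
Lemma rectD : semi_setD_closed rect.
Proof.
move=> _ _ [[A B] [/= mA mB] <-] [[C D] [/= mC mD] <-].
have [S1 [fS1 mS1 AC tS1]] := semi_measurableD _ _ mA mC.
have [S2 [fS2 mS2 BD tS2]] := semi_measurableD _ _ mB mD.
have S1P X x : S1 X -> X x -> A x /\ ~ C x.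
  by move=> SX Xx; have : (A `\` C) x by rewrite AC; exists X.
have S2P X x : S2 X -> X x -> B x /\ ~ D x.
  by move=> SX Xx; have : (B `\` D) x by rewrite BD; exists X.
exists ([set X `*` B | X in S1] `|` [set (A `&` C) `*` Y | Y in S2]); split.
- by rewrite finite_setU; split; exact: finite_image.
- move=> _ [[X /mS1 mX <-]|[Y /mS2 mY <-]]; apply: is_rect => //.
  exact: measurableI.
- apply/seteqP; split=> [[x y] [/= [Ax By] nCD]|[x y]].
    have [Cx|nCx] := pselect (C x); last first.
      have : (A `\` C) x by [].
      by rewrite AC => -[X SX Xx]; exists (X `*` B) => //; left; exists X.
    have : (B `\` D) y by split => // Dy; exact: nCD.
    rewrite BD => -[Y SY Yy].
    by exists ((A `&` C) `*` Y) => //; right; exists Y.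
  move=> [_ [[X SX <-]|[Y SY <-]]] /= [].
    by move=> /(S1P _ _ SX) [Ax nCx] By; split => //; case.
  by move=> [Ax Cx] /(S2P _ _ SY) [By nDy]; split => //; case.
- move=> _ _ [[X SX <-]|[X SX <-]] [[Y SY <-]|[Y SY <-]] [[x y]] /=.
  + move=> [[Xx By] [Yx _]]; congr (_ `*` _).
    by apply: tS1 => //; exists x.
  + by move=> [[/(S1P _ _ SX)[]]] ? ? ? [[]].
  + by move=> [[[_ Cx] _]] [/(S1P _ _ SY)[]].
  + move=> [[_ Xy] [_ Yy]]; congr (_ `*` _).
    by apply: tS2 => //; exists y.
Qed.

(** Closed with [Qed], so that it does not unfold to the display of the product sigma-algebra. *)
Definition rect_display : measure_display.
Proof. exact: (measure_prod_display (d1, d2)). Qed.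

HB.instance Definition _ := Pointed.on rect_type.
HB.instance Definition _ :=
  @isSemiRingOfSets.Build rect_display rect_type rect rect0 rectI rectD.
End product_semiring.

Section rect_measurability.
Context (R : realType).

Definition ocrect : Type := rect_type (ocitv_type R) (ocitv_type R).
HB.instance Definition _ := SemiRingOfSets.on ocrect.

Lemma is_ocrect (a b c e : R) :
  measurable (`]a, b]%classic `*` `]c, e]%classic : set ocrect).
Proof. by apply: is_rect; exact: is_ocitv. Qed.

Definition ocrect_sigma := g_sigma_algebraType (@measurable _ ocrect).

(** The identity into the plane is measurable because its two coordinates are: the preimage of []a,
    b]] is a strip, a countable union of half-open rectangles. *)
Lemma rect_semiring_borel (A : set (R * R)) : measurable A ->
  measurable (A : set ocrect_sigma).
Proof.
suff mid : measurable_fun [set: ocrect_sigma] (fun x : ocrect_sigma => (x : R * R)).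
  by move=> mA; have := mid measurableT _ mA; rewrite setTI.
have mstrip (f : ocrect_sigma -> R) :
  (forall a b, measurable (f @^-1` `]a, b])) -> measurable_fun setT f.
  move=> mf; apply: (@measurability _ _ _ _ _ _ (@ocitv R)) => //.
  by move=> _ [_ [[a b] _ <-] <-]; rewrite setTI; exact: mf.
apply/measurable_fun_pairP; split; apply: mstrip => a b.
  rewrite (_ : _ @^-1` _ = `]a, b]%classic `*` setT); last first.
    by apply/seteqP; split=> [[x y]|[x y] []].
  rewrite -(bigcup_itvT false false) setX_bigcupr.
  by apply: bigcup_measurable => n _; apply: sub_sigma_algebra; exact: is_ocrect.
rewrite (_ : _ @^-1` _ = setT `*` `]a, b]%classic); last first.
  by apply/seteqP; split=> [[x y]|[x y] []].
rewrite -(bigcup_itvT false false) setX_bigcupl.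
by apply: bigcup_measurable => n _; apply: sub_sigma_algebra; exact: is_ocrect.
Qed.
End rect_measurability.

(** * Grids on the unit interval *)

Section clamp.
Context (R : realType).
Implicit Types x y : R.

Definition clamp x : R := Num.min 1 (Num.max 0 x).

Lemma clamp_cases x : [\/ x <= 0 /\ clamp x = 0, 0 <= x <= 1 /\ clamp x = x
  | 1 <= x /\ clamp x = 1].
Proof.
rewrite /clamp; have [x0|x0] := leP x 0.
  by rewrite min_r ?ler01//; apply: Or31.
have [x1|x1] := leP x 1; last by apply: Or33; rewrite ltW.
by apply: Or32; rewrite ltW.
Qed.

Lemma clamp_itv x : 0 <= clamp x <= 1.
Proof. by case: (clamp_cases x) => -[? ->]; lra. Qed.

Lemma clamp_id x : 0 <= x <= 1 -> clamp x = x.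
Proof. by case: (clamp_cases x) => -[? ->]; lra. Qed.

Lemma le_clamp : {homo clamp : x y / x <= y}.
Proof.
by move=> x y; case: (clamp_cases x) => -[? ->]; case: (clamp_cases y) => -[? ->]; lra.
Qed.

Lemma clamp_lip x y : `|clamp x - clamp y| <= `|x - y|.
Proof.
wlog xy : x y / x <= y.
  move=> h; have /orP[|yx] := le_total x y; first exact: h.
  by rewrite distrC [leRHS]distrC; exact: h.
rewrite distrC [leRHS]distrC !ger0_norm ?subr_ge0 ?le_clamp//.
by case: (clamp_cases x) => -[? ->]; case: (clamp_cases y) => -[? ->]; lra.
Qed.
End clamp.

Section rect_vol.
Context (R : realType).

Definition rect_vol (F : R -> R -> R) (a b c d : R) : R :=
  F b d - F b c - F a d + F a c.

(* A function that is determined by its restriction to the unit square, so that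
   a grid on that square suffices to approximate its volume. *)
Record unit_df := {
  df :> R -> R -> R ;
  df_vol : forall a b c d, a <= b -> c <= d -> 0 <= rect_vol df a b c d ;
  df_lip : forall u v u' v', `|df u v - df u' v'| <= `|u - u'| + `|v - v'| ;
  df_clamp : forall u v, df u v = df (clamp u) (clamp v) }.
End rect_vol.

Section grid_round.
Context (R : realType) (n : nat).
Implicit Types a b x : R.

Definition node (i : nat) : R := i%:R / n.+1%:R.

Lemma le_node i j : (i <= j)%N -> node i <= node j.
Proof. by move=> ij; rewrite ler_pM2r ?invr_gt0// ler_nat. Qed.

(** [Num.truncn] is 0 on negative numbers and [minn] caps the index, so outside of the unit interval
    too this is [clamp x] rounded down to a node. *)
Definition grid_round (x : R) : R := node (minn n.+1 (Num.truncn (x * n.+1%:R))).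

Lemma grid_round_dist x : `|grid_round x - clamp x| <= n.+1%:R^-1.
Proof.
have n0 : 0 < n.+1%:R :> R by rewrite ltr0n.
have [e e0 eE] : exists2 e : R, 0 < e & n.+1%:R^-1 = e.
  by exists n.+1%:R^-1 => //; rewrite invr_gt0.
rewrite /grid_round /node; case: leqP => h.
  have x1 : 1 <= x by move: h; rewrite truncn_gt_nat ler_pMl.
  rewrite divff ?gt_eqF// eE ler_norml.
  by clear eE n0; case: (clamp_cases x) => -[? ->]; lra.
have [x0|x0] := leP 0 x; last first.
  have -> : Num.truncn (x * n.+1%:R) = 0%N.
    by apply/truncn0Pn; rewrite -ltNge (lt_trans _ ltr01)// pmulr_llt0.
  rewrite mul0r eE ler_norml.
  by clear eE n0; case: (clamp_cases x) => -[? ->]; lra.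
have /truncn_itv/andP[] : 0 <= x * n.+1%:R by rewrite mulr_ge0// ltW.
set m := Num.truncn _ in h *.
rewrite -ler_pdivrMr// => mx; rewrite -ltr_pdivlMr// => xm.
have x1 : x <= 1.
  by rewrite ltW// (lt_le_trans xm)// ler_pdivrMr// mul1r ler_nat.
move: mx xm; rewrite -(natr1 m) mulrDl div1r eE => mx xm.
rewrite clamp_id ?x0// ler_norml.
by move: mx xm; set y := m%:R * e; clear; lra.
Qed.

(** The nodes [node i.+1] up to [x] are those with [i] below the truncation of [x * n.+1], so the
    increments up to [x] telescope. The claim is the difference of this for [b] and [a]. *)
Lemma grid_round_telescope (g : R -> R) a b : a <= b ->
  \sum_(i < n.+1) (g (node i.+1) - g (node i)) * (a < node i.+1 <= b)%R%:R =
  g (grid_round b) - g (grid_round a).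
Proof.
move=> ab.
have node_le x i : (node i.+1 <= x) = (i < Num.truncn (x * n.+1%:R))%N.
  by rewrite truncn_gt_nat /node ler_pdivrMr// ltr0n.
have upto x : \sum_(i < n.+1) (g (node i.+1) - g (node i)) * (node i.+1 <= x)%R%:R
    = g (grid_round x) - g (node 0).
  rewrite (eq_bigr (fun i : 'I_n.+1 => if (i < Num.truncn (x * n.+1%:R))%N then
      g (node i.+1) - g (node i) else 0)); last first.
    by move=> i _; rewrite node_le; case: ifP; rewrite ?mulr1 ?mulr0.
  rewrite -big_mkcond -(big_mkord (fun i => (i < Num.truncn (x * n.+1%:R))%N)
    (fun i => g (node i.+1) - g (node i)))/= /grid_round.
  rewrite -(telescope_sumr (fun i => g (node i)) (leq0n _)).
  rewrite [RHS](big_nat_widen _ _ n.+1) ?geq_minl//.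
  rewrite big_nat_cond [RHS]big_nat_cond; apply: eq_bigl => i.
  by rewrite /= leq_min; case: (i < n.+1)%N.
rewrite (_ : _ - _ = (g (grid_round b) - g (node 0)) - (g (grid_round a) - g (node 0)));
  last by lra.
rewrite -!upto -sumrB; apply: eq_bigr => i _; rewrite -mulrBr; congr (_ * _).
rewrite ltNge; have [ia|ia]/= := boolP (node i.+1 <= a); last by rewrite subr0.
by rewrite (le_trans ia ab) subrr.
Qed.
End grid_round.

(** * Discrete measures carried by grids, and their limit on rectangles *)

Section grid_measure.
Context (R : realType) (F : unit_df R).

Section fixed_grid.
Variable n : nat.
Let x (i : nat) : R := node R n i.

Lemma cell_ge0 i j : 0 <= rect_vol F (x i) (x i.+1) (x j) (x j.+1).
Proof. by apply: df_vol; exact: le_node. Qed.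

(** The mass of a cell sits at its upper right corner, the one that belongs to the half-open
    cell. *)
Definition grid_measure : set (R * R) -> \bar R :=
  msum (fun i => msum (fun j =>
    mscale (NngNum (cell_ge0 i j)) (\d_(x i.+1, x j.+1))) n.+1) n.+1.
HB.instance Definition _ := Measure.on grid_measure.

(** The double sum telescopes in the first variable and, for each column of cells, in the second. *)
Lemma grid_measure_rect (a b c d : R) : a <= b -> c <= d ->
  grid_measure (`]a, b]%classic `*` `]c, d]%classic) =
  (rect_vol F (grid_round n a) (grid_round n b) (grid_round n c)
              (grid_round n d))%:E.
Proof.
move=> ab cd.
transitivity (\sum_(i < n.+1) \sum_(j < n.+1)
    rect_vol F (x i) (x i.+1) (x j) (x j.+1) *
    ((c < x j.+1 <= d)%R%:R * (a < x i.+1 <= b)%R%:R))%:E.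
  rewrite -sumEFin; apply: eq_bigr => i _; rewrite -sumEFin; apply: eq_bigr => j _.
  transitivity ((rect_vol F (x i) (x i.+1) (x j) (x j.+1))%:E *
    \d_(x i.+1, x j.+1) (`]a, b]%classic `*` `]c, d]%classic))%E => //.
  rewrite diracE in_setX -EFinM.
  by rewrite !mem_setE !in_itv/= -natrM mulnb andbC.
set ra := grid_round n a; set rb := grid_round n b.
set rc := grid_round n c; set rd := grid_round n d.
rewrite (_ : rect_vol F ra rb rc rd = (F rb rd - F rb rc) - (F ra rd - F ra rc));
  last by rewrite /rect_vol; lra.
have /= <- := grid_round_telescope n (fun y => F y rd - F y rc) ab.
congr _%:E; apply: eq_bigr => i _; under eq_bigr do rewrite mulrA.
rewrite -mulr_suml; congr (_ * _).
rewrite (_ : _ - _ = (F (x i.+1) rd - F (x i) rd) - (F (x i.+1) rc - F (x i) rc));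
  last by rewrite /x; lra.
have /= <- := grid_round_telescope n (fun y => F (x i.+1) y - F (x i) y) cd.
by apply: eq_bigr => j _; rewrite /rect_vol /x; congr (_ * _); lra.
Qed.
End fixed_grid.

(** [df_clamp] moves the point into the unit square, where rounding shifts each coordinate by at
    most [1 / n.+1]; then [df_lip] applies. *)
Lemma cvg_df_grid_round (u v : R) :
  F (grid_round n u) (grid_round n v) @[n --> \oo] --> F u v.
Proof.
apply/cvgrPdist_le => e e0; near=> n.
rewrite (df_clamp F u v) (le_trans (df_lip _ _ _ _ _))//.
rewrite distrC (distrC _ (grid_round n v)).
rewrite (le_trans (lerD (grid_round_dist _ _) (grid_round_dist _ _)))//.
have : n.+1%:R^-1 < e / 2.
  by near: n; apply: near_infty_natSinv_lt (PosNum (divr_gt0 e0 (ltr0Sn R 1))).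
by set y := _^-1; clear; lra.
Unshelve. all: by end_near. Qed.

Lemma cvg_grid_measure_rect (a b c d : R) : a <= b -> c <= d ->
  grid_measure n (`]a, b]%classic `*` `]c, d]%classic) @[n --> \oo] -->
  (rect_vol F a b c d)%:E.
Proof.
move=> ab cd; under eq_fun do rewrite grid_measure_rect//.
apply: cvg_EFin; first by near=> n.
by apply: cvgD; [apply: cvgB; [apply: cvgB|]|]; exact: cvg_df_grid_round.
Unshelve. all: by end_near. Qed.

(* On rectangles the limit exists; the lower limit is a value for all sets. *)
Definition rect_content (S : set (ocrect R)) : \bar R :=
  limn_einf (fun n => grid_measure n S).

Lemma rect_content_rect (a b c d : R) : a <= b -> c <= d ->
  rect_content (`]a, b]%classic `*` `]c, d]%classic) = (rect_vol F a b c d)%:E.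
Proof.
move=> ab cd; rewrite /rect_content.
have h := cvg_grid_measure_rect ab cd.
by rewrite is_cvg_limn_einfE; [exact/cvg_lim|apply/cvg_ex; eexists; exact: h].
Qed.

End grid_measure.

(** * The Stieltjes measure of a bivariate distribution function *)

(* [compact_cover] is stated for pointed topological types. *)
HB.instance Definition _ (U V : ptopologicalType) :=
  Topological.on (U * V)%type.

Section rect_content.
Context (R : realType) (F : unit_df R).

Lemma ocrectP (S : set (ocrect R)) : measurable S ->
  S = set0 \/ exists a b c d : R,
    [/\ a < b, c < d & S = `]a, b]%classic `*` `]c, d]%classic].
Proof.
move=> [[A B] [/= /ocitvP[->|[[a b] /= ab ->]] /ocitvP[->|[[c d] /= cd ->]]] <-];
  rewrite ?set0X ?setX0; try by left.
by right; exists a, b, c, d.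
Qed.

(** The empty set is written as a degenerate rectangle, so that one form covers the whole
    semiring. *)
Lemma ocrect_le (S : set (ocrect R)) : measurable S ->
  exists x : R * R * (R * R),
    [/\ x.1.1 <= x.1.2, x.2.1 <= x.2.2 &
      S = `]x.1.1, x.1.2]%classic `*` `]x.2.1, x.2.2]%classic].
Proof.
move=> /ocrectP[->|[a [b [c [d [/ltW ab /ltW cd ->]]]]]];
  last by exists ((a, b), (c, d)).
by exists ((0, 0), (0, 0)); split; rewrite //= set_itvoc0 set0X.
Qed.

Lemma measurable_ocrect (S : set (ocrect R)) : measurable S ->
  measurable (S : set (R * R)).
Proof.
by move=> /ocrect_le[x [_ _ ->]]; apply: measurableX; exact: measurable_itv.
Qed.

Lemma cvg_rect_content (S : set (ocrect R)) : measurable S ->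
  grid_measure F n S @[n --> \oo] --> rect_content F S.
Proof.
move=> /ocrect_le[x [ab cd ->]].
by rewrite rect_content_rect//; exact: cvg_grid_measure_rect.
Qed.

Let rect_content_ge0 (S : set (ocrect R)) : (0 <= rect_content F S)%E.
Proof.
rewrite /rect_content limn_einf_lim; apply: lime_ge; first exact: is_cvg_einfs.
by near=> n; apply: le_ereal_inf_tmp => _ [k _ <-]; exact: measure_ge0.
Unshelve. all: by end_near. Qed.

(** Every grid measure is additive, and additivity passes to the limit, which exists on
    rectangles. *)
Let rect_content_semi_additive :
  measure_function.semi_additive (rect_content F : set (ocrect R) -> \bar R).
Proof.
move=> G n mG tG mUG.
apply: cvg_unique (cvg_rect_content mUG) _ => //.
rewrite (_ : (fun k => _) = fun k => (\sum_(i < n) grid_measure F k (G i))%E); last first.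
  apply/funext => k; rewrite measure_semi_additive//.
    by move=> i; exact: measurable_ocrect.
  exact: measurable_ocrect.
apply: cvg_nnesum => i _; first by near=> k.
exact: cvg_rect_content.
Unshelve. all: by end_near. Qed.

HB.instance Definition _ := isContent.Build _ (ocrect R) R (rect_content F)
  rect_content_ge0 rect_content_semi_additive.

(** Each coordinate occurs in two of the four corners, hence the factor 2. *)
Lemma rect_vol_lip (a b c d a' b' c' d' : R) :
  `|rect_vol F a b c d - rect_vol F a' b' c' d'| <=
  2 * (`|a - a'| + `|b - b'| + `|c - c'| + `|d - d'|).
Proof.
have := df_lip F b d b' d'; have := df_lip F b c b' c'.
have := df_lip F a d a' d'; have := df_lip F a c a' c'.
rewrite /rect_vol !ler_norml.
move: `|a - _| `|b - _| `|c - _| `|d - _| => *; lra.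
Qed.

(** Shrink [A] to a compact rectangle, enlarge every [G n] to an open one, extract a finite subcover
    and apply finite subadditivity. Shrinking and enlarging cost at most half of the tolerance
    each. *)
Lemma rect_content_sigma_subadditive :
  measurable_subset_sigma_subadditive (rect_content F : set (ocrect R) -> \bar R).
Proof.
move=> A G mG mA AG.
have [A0|[a [b [c [d [ab cd AE]]]]]] := ocrectP mA.
  by rewrite A0 measure0 nneseries_esum ?esum_ge0.
have /choice[g gP] := fun n => ocrect_le (mG n).
apply/lee_addgt0Pr => _/posnumP[e].
rewrite [e%:num]splitr [in leRHS]EFinD addeA -leeBlDr//.
apply: le_trans (epsilon_trick _ _ _) => //=.
(* Moving two sides by [r n] changes the volume by at most [4 * r n], which is the [n]-th term of
   [epsilon_trick] for half of the tolerance. *)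
pose r n : R := (e%:num / 2) / 2 ^ n.+1 / 4.
have r0 n : 0 < r n by rewrite /r !divr_gt0// exprn_gt0.
(* Two shifts of at most an eighth of the tolerance cost at most half of it by [rect_vol_lip]. Since
   [a < a'] and [c < c'], the closed rectangle from [(a', c')] to [(b, d)] lies in [A]. *)
pose a' := Num.min (a + e%:num / 8) b; pose c' := Num.min (c + e%:num / 8) d.
have e0 : 0 < e%:num by [].
have a'P : [/\ a < a', a' <= b & a' <= a + e%:num / 8].
  by rewrite /a'; case: (leP (a + e%:num / 8) b); split; lra.
have c'P : [/\ c < c', c' <= d & c' <= c + e%:num / 8].
  by rewrite /c'; case: (leP (c + e%:num / 8) d); split; lra.
case: a'P c'P => aa' a'b a'e [cc' c'd c'e].
pose O n := `](g n).1.1, (g n).1.2 + r n[%classic `*`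
            `](g n).2.1, (g n).2.2 + r n[%classic.
pose G' n := `](g n).1.1, (g n).1.2 + r n]%classic `*`
             `](g n).2.1, (g n).2.2 + r n]%classic.
have KO : `[a', b]%classic `*` `[c', d]%classic `<=` \bigcup_n O n.
  move=> [x y] [/=]; rewrite !in_itv/= => /andP[a'x xb] /andP[c'y yd].
  have /AG[n _] : A (x, y).
    rewrite AE; split; rewrite /= in_itv/= ?xb ?yd andbT.
      exact: lt_le_trans a'x.
    exact: lt_le_trans c'y.
  have [_ _ ->] := gP n; move=> [/=]; rewrite !in_itv/= => /andP[? ?] /andP[? ?].
  have rn := r0 n.
  by exists n => //; split; rewrite /= in_itv/=; apply/andP; split => //; lra.
have oO n : [set: nat] n -> open (O n).
  move=> _; rewrite /O (_ : _ `*` _ =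
    fst @^-1` `](g n).1.1, (g n).1.2 + r n[ `&`
    snd @^-1` `](g n).2.1, (g n).2.2 + r n[)//.
  by apply: openI; apply: open_comp => [[? ?] _|];
    [exact: cvg_fst|exact: interval_open|exact: cvg_snd|exact: interval_open].
have := compact_setX (@segment_compact _ a' b) (@segment_compact _ c' d).

rewrite compact_cover => /(_ _ _ _ oO KO)[X _ KX].
have mG' n : measurable (G' n : set (ocrect R)) by exact: is_ocrect.
have gle n : (g n).1.1 <= (g n).1.2 + r n /\ (g n).2.1 <= (g n).2.2 + r n.
  by have [? ? _] := gP n; have := r0 n; split; lra.
have sub : `]a', b]%classic `*` `]c', d]%classic `<=` \bigcup_(i in [set` X]) G' i.
  apply: (@subset_trans _ (`[a', b]%classic `*` `[c', d]%classic)).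
    by move=> [x y] [? ?]; split; exact: subset_itv_oc_cc.
  apply: subset_trans KX _ => -[x y] [n Xn] [? ?]; exists n => //.
  by split; exact: subset_itv_oo_oc.
have := content_sub_fsum (rect_content F) (finite_fset X) (fun n _ => mG' n)
  (is_ocrect a' b c' d) sub.
rewrite fsbig_finite//= set_fsetK AE [in leLHS]rect_content_rect//.
rewrite rect_content_rect ?(ltW ab) ?(ltW cd)// => le_sum.
apply: (@le_trans _ _ (rect_vol F a' b c' d)%:E).
  rewrite lee_fin lerBlDr.
  have /ler_normlP[_] := rect_vol_lip a b c d a' b c' d; rewrite !subrr normr0.
  have : `|a - a'| <= e%:num / 8 by rewrite ler_norml; lra.
  have : `|c - c'| <= e%:num / 8 by rewrite ler_norml; lra.
  move: `|a - _| `|c - _| (rect_vol _ _ _ _ _) (rect_vol _ _ _ _ _) (e%:num).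
  by clear => *; lra.
apply: (le_trans le_sum).
apply: (@le_trans _ _ (\sum_(n <- X)
    (rect_content F (G n) + (e%:num / 2 / (2 ^ n.+1)%:R)%:E))%E).
  apply: lee_sum => n _; have [? ? GE] := gP n; have [? ?] := gle n.
  rewrite GE !rect_content_rect// -EFinD lee_fin natrX -lerBlDl.
  have /ler_normlP[_] := rect_vol_lip (g n).1.1 ((g n).1.2 + r n)
    (g n).2.1 ((g n).2.2 + r n)
    (g n).1.1 (g n).1.2 (g n).2.1 (g n).2.2.
  have rE x : x + r n - x = r n by lra.
  rewrite !rE !subrr normr0 (ger0_norm (ltW (r0 n))).
  rewrite (_ : e%:num / 2 / _ = 4 * r n); last by rewrite /r; lra.
  by move: (r n) (rect_vol _ _ _ _ _) (rect_vol _ _ _ _ _); clear => *; lra.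
rewrite nneseries_esum; last by move=> n _; rewrite adde_ge0.
rewrite esum_ge//; exists [set` X] => //; rewrite fsbig_finite//= set_fsetK//.
Qed.

HB.instance Definition _ := Content_SigmaSubAdditive_isMeasure.Build _ R (ocrect R)
  (rect_content F) rect_content_sigma_subadditive.
End rect_content.

Section df_measure.
Context (R : realType) (F : unit_df R).

Let D : set (R * R) := `]-1, 1]%classic `*` `]-1, 1]%classic.

(* The restriction to [D], which contains the unit square, has total mass 1. *)
Definition df_measure (A : set (R * R)) : \bar R :=
  measure_extension (rect_content F) (A `&` D).

Let mD (A : set (R * R)) : measurable A -> measurable (A `&` D : set (ocrect_sigma R)).
Proof.
move=> mA; apply: rect_semiring_borel; apply: measurableI => //.
by apply: measurableX; exact: measurable_itv.
Qed.

Let df_measure0 : df_measure set0 = 0%E.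
Proof. by rewrite /df_measure set0I measure0. Qed.

Let df_measure_ge0 A : (0 <= df_measure A)%E.
Proof. exact: measure_ge0. Qed.

Let df_measure_sigma_additive : semi_sigma_additive df_measure.
Proof.
move=> A mA tA mUA; rewrite /df_measure setI_bigcupl.
apply: (@measure_semi_sigma_additive _ _ _ (measure_extension (rect_content F))
  (fun k => A k `&` D)) => [k||].
- by apply: mD; exact: mA.
- by apply/trivIset_setIr.
- by rewrite -setI_bigcupl; apply: mD; exact: mUA.
Qed.

HB.instance Definition _ := isMeasure.Build _ (R * R)%type R df_measure
  df_measure0 df_measure_ge0 df_measure_sigma_additive.

Lemma df_measure_rect (a b c d : R) : -1 <= a -> a <= b -> b <= 1 ->
  -1 <= c -> c <= d -> d <= 1 ->
  df_measure (`]a, b]%classic `*` `]c, d]%classic) = (rect_vol F a b c d)%:E.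
Proof.
move=> a1 ab b1 c1 cd d1; rewrite /df_measure setIidl; last first.
  move=> [x y] [/=]; rewrite !in_itv/= => /andP[? ?] /andP[? ?].
  by split; rewrite /= in_itv/=; apply/andP; split; lra.
rewrite -rect_content_rect//; apply: measurable_mu_extE; exact: is_ocrect.
Qed.

Hypothesis F0l : forall v, F 0 v = 0.
Hypothesis F0r : forall u, F u 0 = 0.
Hypothesis F11 : F 1 1 = 1.

(** The lower sides of [D] lie at -1, where [F] takes the values that it has at 0, and so
    vanishes. *)
Let clampN1 : clamp (-1) = clamp 0 :> R.
Proof.
by case: (clamp_cases (-1 : R)) => -[? ->]; case: (clamp_cases (0 : R)) => -[? ->]; lra.
Qed.

Let FNl v : F (- 1) v = 0. Proof. by rewrite df_clamp clampN1 -df_clamp. Qed.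

Let FNr u : F u (- 1) = 0. Proof. by rewrite df_clamp clampN1 -df_clamp. Qed.

Let df_measure_setT : df_measure setT = 1%E.
Proof.
transitivity (df_measure D); first by rewrite /df_measure setTI setIid.
rewrite df_measure_rect//; [|lra..].
by rewrite /rect_vol FNl FNl FNr F11; congr _%:E; lra.
Qed.

HB.instance Definition _ :=
  @Measure_isProbability.Build _ _ R df_measure df_measure_setT.

(** The closed rectangle is squeezed between the half-open ones that start at 0 and at -1. Both have
    mass [F u v], as [F] vanishes on their lower sides. *)
Lemma exists_distribution : exists P : probability (R * R)%type R,
  has_distribution_function F P.
Proof.
exists df_measure => u v /andP[u0 u1] /andP[v0 v1].
have m (I J : interval R) : measurable ([set` I] `*` [set` J]).
  by apply: measurableX; exact: measurable_itv.
apply/eqP; rewrite eq_le; apply/andP; split.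
  have <- : df_measure (`]-1, u]%classic `*` `]-1, v]%classic) = (F u v)%:E.
    rewrite df_measure_rect//; [|lra..].
    by rewrite /rect_vol FNl FNl FNr; congr _%:E; lra.
  apply: le_measure; [by apply/mem_set; exact: m|by apply/mem_set; exact: m|].
  move=> [x y] [/=]; rewrite !in_itv/= => /andP[? ?] /andP[? ?].
  by split; rewrite /= ?in_itv/=; apply/andP; split; lra.
have <- : df_measure (`]0, u]%classic `*` `]0, v]%classic) = (F u v)%:E.
  rewrite df_measure_rect//; [|lra..].
  by rewrite /rect_vol F0l F0l F0r; congr _%:E; lra.
apply: le_measure; [by apply/mem_set; exact: m|by apply/mem_set; exact: m|].
by move=> [x y] [? ?]; split; exact: subset_itv_oc_cc.
Qed.
End df_measure.

(** * Lipschitz continuity of copulas and existence of their measures *)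

Section copula_measure.
Context (R : realType) (C : R -> R -> R).
Hypothesis copC : is_copula C.

(** The rectangles over [[u, u']] with heights [[0, v]] and [[v, 1]] have nonnegative volume; the
    first gives the lower bound, the second the upper one. *)
Lemma copula_le1 (u u' v : R) : 0 <= u -> u <= u' -> u' <= 1 -> 0 <= v <= 1 ->
  0 <= C u' v - C u v <= u' - u.
Proof.
case: copC => _ C1 C2 C3 u0 uu' u1 /andP[v0 v1].
have := C3 u u' 0 v u0 uu' u1 (lexx _) v0 v1.
have := C3 u u' v 1 u0 uu' u1 v0 v1 (lexx _).
have [|-> ->] := C1 u; first lra.
have [|-> ->] := C1 u'; first lra.
lra.
Qed.

Lemma copula_le2 (u v v' : R) : 0 <= v -> v <= v' -> v' <= 1 -> 0 <= u <= 1 ->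
  0 <= C u v' - C u v <= v' - v.
Proof.
case: copC => _ C1 C2 C3 v0 vv' v1 /andP[u0 u1].
have := C3 0 u v v' (lexx _) u0 u1 v0 vv' v1.
have := C3 u 1 v v' u0 u1 (lexx _) v0 vv' v1.
have [|-> ->] := C2 v; first lra.
have [|-> ->] := C2 v'; first lra.
lra.
Qed.

Lemma copula_lip (u v u' v' : R) : 0 <= u <= 1 -> 0 <= u' <= 1 ->
  0 <= v <= 1 -> 0 <= v' <= 1 -> `|C u v - C u' v'| <= `|u - u'| + `|v - v'|.
Proof.
move=> u01 u'01 v01 v'01.
rewrite (_ : _ - _ = (C u v - C u' v) + (C u' v - C u' v')); last lra.
rewrite (le_trans (ler_normD _ _))// lerD//.
- wlog uu' : u u' u01 u'01 / u <= u'.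
    move=> h; have /orP[|uu'] := le_total u u'; first exact: h.
    by rewrite distrC [leRHS]distrC; exact: h.
  rewrite distrC [leRHS]distrC.
  have := @copula_le1 u u' v _ uu' _ v01.
  case/andP: u01 => u0 _; case/andP: u'01 => _ u'1.
  by move=> /(_ u0 u'1)/andP[? ?]; rewrite !ger0_norm// subr_ge0.
- wlog vv' : v v' v01 v'01 / v <= v'.
    move=> h; have /orP[|vv'] := le_total v v'; first exact: h.
    by rewrite distrC [leRHS]distrC; exact: h.
  rewrite distrC [leRHS]distrC.
  have := @copula_le2 u' v v' _ vv' _ u'01.
  case/andP: v01 => v0 _; case/andP: v'01 => _ v'1.
  by move=> /(_ v0 v'1)/andP[? ?]; rewrite !ger0_norm// subr_ge0.
Qed.

(** Outside of the unit square [C] is arbitrary; clamping replaces it there by values that satisfy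
    the conditions of [unit_df]. *)
Let F (u v : R) : R := C (clamp u) (clamp v).

Let F_vol (a b c d : R) : a <= b -> c <= d -> 0 <= rect_vol F a b c d.
Proof.
move=> ab cd; case: copC => _ _ _; apply; rewrite ?le_clamp//.
- by have /andP[] := clamp_itv a.
- by have /andP[] := clamp_itv b.
- by have /andP[] := clamp_itv c.
- by have /andP[] := clamp_itv d.
Qed.

Let F_lip (u v u' v' : R) : `|F u v - F u' v'| <= `|u - u'| + `|v - v'|.
Proof. by rewrite (le_trans (copula_lip _ _ _ _)) ?clamp_itv// lerD// clamp_lip. Qed.

Let F_clamp (u v : R) : F u v = F (clamp u) (clamp v).
Proof. by rewrite /F !(clamp_id (clamp_itv _)). Qed.

(** [xget] picks a measure with this property as soon as there is one, so existence is enough. *)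
Lemma copula_measure_df : has_distribution_function C (copula_measure C).
Proof.
pose D := Build_unit_df F_vol F_lip F_clamp.
have c0 : clamp 0 = 0 :> R by rewrite clamp_id//; lra.
have c1 : clamp 1 = 1 :> R by rewrite clamp_id//; lra.
case: copC => _ C1 C2 _.
apply: (xgetPex (@dirac _ (R * R)%type (0, 0) R : probability _ _)
        (P := [set P | has_distribution_function C P])).
have [|||P PD] := @exists_distribution R D.
- by move=> v; rewrite /= /F c0; have [|->] := C2 (clamp v); rewrite ?clamp_itv.
- by move=> u; rewrite /= /F c0; have [|->] := C1 (clamp u); rewrite ?clamp_itv.
- by rewrite /= /F c1; have [|_ ->] := C1 1; rewrite ?ler01 ?lexx.
exists P => u v u01 v01.
by rewrite PD//= /F !clamp_id.
Qed.
End copula_measure.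

(** * Hoeffding's identity *)

Section hoeffding.
Context (R : realType).
Notation T := (measurableTypeR R).

(* The library does not make the product of two sigma-finite measures
   sigma-finite canonically. *)
Definition lebesgue2 : set (T * T) -> \bar R :=
  (lebesgue_measure \x lebesgue_measure)%E.
HB.instance Definition _ := Measure.on lebesgue2.

Let lebesgue2_sigma_finite : sigma_finite setT lebesgue2.
Proof.
exists (fun n => `](- n%:R), n%:R]%classic `*` `](- n%:R), n%:R]%classic).
  apply/esym; rewrite -subTset => -[x y] _.
  have xy0 : 0 <= Num.max `|x| `|y| by rewrite le_max normr_ge0.
  exists (Num.bound (Num.max `|x| `|y|)) => //.
  have := archi_boundP xy0; rewrite gt_max => /andP[xn yn].
  have xb := ltr_normlW xn; have yb := ltr_normlW yn.
  have xb' := ltr_normlW (etrans (congr1 (fun z => z < _) (normrN x)) xn).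
  have yb' := ltr_normlW (etrans (congr1 (fun z => z < _) (normrN y)) yn).
  by split; rewrite /= in_itv/= ltrNl; apply/andP; split=> //; exact: ltW.
move=> n; split; first by apply: measurableX; exact: measurable_itv.
rewrite /lebesgue2 product_measure1E; [|exact: measurable_itv..].
rewrite /= !lebesgue_measure_itv/=; case: ifP; rewrite ?mule0 ?ltey//.
Qed.
HB.instance Definition _ :=
  @Measure_isSigmaFinite.Build _ _ _ lebesgue2 lebesgue2_sigma_finite.

Definition unit_square : set (R * R) := `[0, 1]%classic `*` `[0, 1]%classic.

Lemma unit_squareP (x : R * R) :
  unit_square x <-> (0 <= x.1 <= 1) /\ (0 <= x.2 <= 1).
Proof. by rewrite /unit_square /= ?in_itv. Qed.

Lemma measurable_unit_square : measurable unit_square.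
Proof. by apply: measurableX; exact: measurable_itv. Qed.

(** The joint survival function of a copula: the probability that both coordinates exceed those of
    [y]. *)
Definition survival (C : R -> R -> R) (y : R * R) : R :=
  1 - y.1 - y.2 + C y.1 y.2.

Lemma survival_le (C C' : R -> R -> R) : 
  (forall u v, 0 <= u <= 1 -> 0 <= v <= 1 -> C u v <= C' u v) ->
  forall y, unit_square y -> survival C y <= survival C' y.
Proof. by move=> CC' y /unit_squareP[? ?]; rewrite lerD2l; exact: CC'. Qed.

(* Its section at [x] is the rectangle [[0, x.1[ x [0, x.2[], of area
   [x.1 * x.2], and its section at [y] is the tail []y.1, 1] x ]y.2, 1]]. *)
Definition below : set ((R * R) * (T * T)) := [set z |
  [&& 0 <= z.2.1, z.2.1 < z.1.1, z.1.1 <= 1, 0 <= z.2.2, z.2.2 < z.1.2 & z.1.2 <= 1]].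

Lemma measurable_below : measurable below.
Proof.
pose p11 (z : (R * R) * (T * T)) := z.1.1; pose p12 (z : (R * R) * (T * T)) := z.1.2.
pose p21 (z : (R * R) * (T * T)) : R := z.2.1.
pose p22 (z : (R * R) * (T * T)) : R := z.2.2.
have m11 : measurable_fun setT p11 by exact: measurableT_comp.
have m12 : measurable_fun setT p12 by exact: measurableT_comp.
have m21 : measurable_fun setT p21.
  have : measurable_fun setT (fun z : (R * R) * (T * T) => z.2.1).
    exact: measurableT_comp.
  exact.
have m22 : measurable_fun setT p22.
  have : measurable_fun setT (fun z : (R * R) * (T * T) => z.2.2).
    exact: measurableT_comp.
  exact.
have mb : measurable_fun setT (fun z : (R * R) * (T * T) => [&& 0 <= p21 z,
    p21 z < p11 z, p11 z <= 1, 0 <= p22 z, p22 z < p12 z & p12 z <= 1]).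
  by repeat apply: measurable_and;
    (apply: measurable_fun_ler || apply: measurable_fun_ltr).
by have := mb measurableT [set true] I; rewrite setTI.
Qed.

Section one_copula.
Variable C : R -> R -> R.
Hypothesis copC : is_copula C.
Let P := copula_measure C.

Let measurable_rect (I J : interval R) :
  measurable ([set` I] `*` [set` J] : set (R * R)).
Proof. by apply: measurableX; exact: measurable_itv. Qed.

Let PD (A B U : set (R * R)) a b : measurable A -> measurable B ->
  U = A `|` B -> A `&` B = set0 -> P U = a%:E -> P A = b%:E -> P B = (a - b)%:E.
Proof.
move=> mA mB UE AB PU PA; have PAB : (P A + P B = a%:E)%E by rewrite -PU UE measureU.
by rewrite EFinB -PAB PA addeAC subee// add0e.
Qed.

(** Removing [[0, s] x [0, u]] from [[0, 1] x [0, u]] gives the mass of []s, 1] x [0, u]]. The tail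
    is the difference of these for [u = 1] and [u = t]. *)
Lemma copula_measure_tail (s t : R) : 0 <= s <= 1 -> 0 <= t <= 1 ->
  P (`]s, 1]%classic `*` `]t, 1]%classic) = (survival C (s, t))%:E.
Proof.
move=> s01 t01; have /andP[s0 s1] := s01; have /andP[t0 t1] := t01.
have PC : has_distribution_function C P by exact: copula_measure_df.
have [_ C1 C2 _] := copC.
have o01 : 0 <= (1 : R) <= 1 by rewrite ler01 lexx.
have PJ (u a : R) : 0 <= u <= 1 -> P (`[0, 1]%classic `*` `[0, u]%classic) = a%:E ->
    P (`]s, 1]%classic `*` `[0, u]%classic) = (a - C s u)%:E.
  move=> u01 Pa.
  apply: (PD (A := `[0, s]%classic `*` `[0, u]%classic) _ _ _ _ Pa) => //.
  - apply/seteqP; split=> [[x y] [+ +]|[x y] [] [+ +]]; rewrite /= ?in_itv/=.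
    + move=> /andP[x0 x1] yu; have [xs|xs] := leP x s; [left|right]; split => //=;
      by apply/andP; split => //; lra.
    + by move=> /andP[x0 x1] yu; split => //; lra.
    + by move=> /andP[x0 x1] yu; split => //; lra.
  - apply/seteqP; split=> [[x y] [[+ _] [+ _]]|//].
    by rewrite /= ?in_itv/= => /andP[? ?] /andP[? ?]; lra.
  - exact: PC.
have P1 : P (`]s, 1]%classic `*` `[0, 1]%classic) = (1 - s)%:E.
  by rewrite (PJ _ 1)// ?PC//; [have [_ ->] := C1 s s01|have [_ ->] := C1 1 o01].
have Pt : P (`]s, 1]%classic `*` `[0, t]%classic) = (t - C s t)%:E.
  by rewrite (PJ _ t)// PC//; have [_ ->] := C2 t t01.
have -> : survival C (s, t) = (1 - s) - (t - C s t) by rewrite /survival/=; lra.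
apply: (PD (A := `]s, 1]%classic `*` `[0, t]%classic) _ _ _ _ P1 Pt) => //.
- apply/seteqP; split=> [[x y] [+ +]|[x y] [] [+ +]]; rewrite /= ?in_itv/=.
  + move=> xs /andP[y0 y1]; have [yt|yt] := leP y t; [left|right]; split => //=;
    by apply/andP; split => //; lra.
  + by move=> xs /andP[x0 x1]; split => //; lra.
  + by move=> xs /andP[x0 x1]; split => //; lra.
- apply/seteqP; split=> [[x y] [[_ +] [_ +]]|//].
  by rewrite /= ?in_itv/= => /andP[? ?] /andP[? ?]; lra.
Qed.

Lemma lebesgue2_section (x : R * R) :
  lebesgue2 (xsection below x) = ((fun x : R * R => (x.1 * x.2)%:E) \_ unit_square) x.
Proof.
rewrite patchE; case: ifPn => [/set_mem/unit_squareP[/andP[a0 a1] /andP[b0 b1]]|].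
  transitivity (lebesgue2 (`[0, x.1[%classic `*` `[0, x.2[%classic)).
    congr (_ _); apply/seteqP; split=> y; rewrite /xsection/= inE.
      move=> /and5P[/= ? ? ? ? /andP[? ?]].
      by split; rewrite /= ?in_itv/=; apply/andP.
    move=> [+ +]; rewrite /= ?in_itv/= => /andP[? ?] /andP[? ?].
    by apply/and5P; split => //=; apply/andP.
  rewrite /lebesgue2 product_measure1E//= !lebesgue_measure_itv/= !lte_fin !sube0.
  have len (a : R) : 0 <= a -> (if 0 < a then a%:E else 0%E) = a%:E.
    by rewrite le_eqVlt => /predU1P[<-|->//]; rewrite ltxx.
  by rewrite !len.
move=> /negP nx; rewrite (_ : xsection _ _ = set0) ?measure0//.
apply/seteqP; split=> // y; rewrite /xsection/= inE => /and5P[? ? ? ? /andP[? ?]].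
by apply: nx; apply/mem_set/unit_squareP; split; lra.
Qed.

Lemma copula_section (y : R * R) :
  P (ysection below y) = ((EFin \o survival C) \_ unit_square) y.
Proof.
rewrite patchE; case: ifPn => [/set_mem/unit_squareP[y1 y2]|].
  rewrite /= [y in RHS]surjective_pairing -copula_measure_tail//.
  congr (P _); apply/seteqP; split=> x; rewrite /ysection/= inE.
    move=> /and5P[/= ? ? ? ? /andP[? ?]].
    by split; rewrite /= ?in_itv/=; apply/andP.
  move=> [+ +]; rewrite /= ?in_itv/= => /andP[? ?] /andP[? ?].
  by case/andP: y1 => ? _; case/andP: y2 => ? _; apply/and5P; split => //=; apply/andP.
move=> /negP ny; rewrite (_ : ysection _ _ = set0) ?measure0//.
apply/seteqP; split=> // x; rewrite /ysection/= inE => /and5P[? ? ? ? /andP[? ?]].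
by apply: ny; apply/mem_set/unit_squareP; split; lra.
Qed.

(** On the unit square this is the mass of the sections of the measurable set [below]. *)
Lemma measurable_survival : measurable_fun unit_square (EFin \o survival C).
Proof.
apply/(measurable_restrictT _ measurable_unit_square).
have <- : P \o ysection below = (EFin \o survival C) \_ unit_square.
  by apply/funext => y; exact: copula_section.
exact: measurable_fun_ysection measurable_below.
Qed.

Lemma survival_ge0 y : unit_square y -> 0 <= survival C y.
Proof.
move=> /unit_squareP[y1 y2]; rewrite -lee_fin [y]surjective_pairing.
by rewrite -copula_measure_tail.
Qed.

(** Tonelli for the indicator of [below]: the two orders of integration give the two sides. *)
Lemma hoeffding : (\int[P]_(x in unit_square) (x.1 * x.2)%:E =
  \int[lebesgue2]_(y in unit_square) (survival C y)%:E)%E.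
Proof.
rewrite integral_mkcond [RHS]integral_mkcond.
transitivity (\int[P]_x \int[lebesgue2]_y (\1_below (x, y))%:E)%E.
  apply: eq_integral => x _.
  rewrite -lebesgue2_section; apply: esym.
  exact: (congr1 (@^~ x) (indic_fubini_tonelli_FE lebesgue2 measurable_below)).
have mf : measurable_fun setT (EFin \o \1_below : (R * R) * (T * T) -> \bar R).
  by apply/measurable_EFinP; exact: measurable_indic measurable_below.
have f0 z : (0 <= (EFin \o \1_below : (R * R) * (T * T) -> \bar R) z)%E.
  by rewrite /= lee_fin indicE ler0n.
apply: etrans (fubini_tonelli (m1 := P) (m2 := lebesgue2) _ mf f0) _.
apply: eq_integral => y _.
rewrite -[RHS]copula_section.
exact: (congr1 (@^~ y) (indic_fubini_tonelli_GE P measurable_below)).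
Qed.

(** By [hoeffding] this is the mean of a product that is at most 1 on the unit square. Finiteness is
    what makes [fine] monotone in [spearman_rho_le]. *)
Lemma survival_integral_fin :
  (\int[lebesgue2]_(y in unit_square) (survival C y)%:E)%E
    \is a fin_num.
Proof.
rewrite -hoeffding ge0_fin_numE; last first.
  apply: integral_ge0 => x /unit_squareP[/andP[? _] /andP[? _]].
  by rewrite lee_fin mulr_ge0.
apply: (@le_lt_trans _ _ (\int[P]_(x in unit_square) (cst 1 x))%E).
  apply: ge0_le_integral => //; first exact: measurable_unit_square.
  - move=> x /unit_squareP[/andP[? _] /andP[? _]].
    by rewrite lee_fin mulr_ge0.
  - apply/measurable_EFinP; apply: measurable_funM; exact: measurable_funTS.
  - move=> x /unit_squareP[/andP[? ?] /andP[? ?]].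
    by rewrite lee_fin mulr_ile1.
rewrite integral_cst ?mul1e ?fin_num_measure//; last exact: measurable_unit_square.
rewrite ltey_eq fin_num_measure//; exact: measurable_unit_square.
Qed.

Lemma spearman_rhoE : spearman_rho C =
  12 * fine (\int[lebesgue2]_(y in unit_square) (survival C y)%:E)%E - 3.
Proof.
rewrite -hoeffding /spearman_rho /concordance /Rintegral /independence_copula.
by rewrite -/P -/unit_square; lra.
Qed.

Lemma survival_integral (h : R -> R) : 
  (forall s : R, 0 <= s <= 1 ->
    (\int[@lebesgue_measure R]_(t in `[0%R, 1%R]) (survival C (s, t))%:E =
     (h s)%:E)%E) ->
  (\int[lebesgue2]_(y in unit_square) (survival C y)%:E =
   \int[@lebesgue_measure R]_(s in `[0%R, 1%R]) (h s)%:E)%E.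
Proof.
move=> Ch; rewrite integral_mkcond /lebesgue2 fubini_tonelli1; first last.
- by apply: erestrict_ge0 => y /survival_ge0; rewrite lee_fin.
- exact: ((measurable_restrictT _ measurable_unit_square).1 measurable_survival).
rewrite [RHS]integral_mkcond; apply: eq_integral => s _.
rewrite /fubini_F patchE; case: ifPn => s01.
  have s01' : 0 <= s <= 1 by move/set_mem: s01; rewrite /= ?in_itv.
  rewrite -Ch// [RHS]integral_mkcond; apply: eq_integral => t _.
  by rewrite !patchE/= /unit_square in_setX/= s01.
apply: integral0_eq => t _; rewrite patchE /unit_square in_setX/=.
by rewrite (negbTE s01).
Qed.
End one_copula.

Lemma spearman_rho_le (C C' : R -> R -> R) : is_copula C -> is_copula C' ->
  (forall u v, 0 <= u <= 1 -> 0 <= v <= 1 -> C u v <= C' u v) ->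
  spearman_rho C <= spearman_rho C'.
Proof.
move=> cC cC' CC'; rewrite !spearman_rhoE// lerB// ler_wpM2l// fine_le//;
  [exact: survival_integral_fin..|].
apply: ge0_le_integral => //.
- exact: measurable_unit_square.
- by move=> y /(survival_ge0 cC); rewrite lee_fin.
- exact: measurable_survival.
- exact: measurable_survival.
- by move=> y /(survival_le CC'); rewrite lee_fin.
Qed.
End hoeffding.

(** * The extremal copulas *)

Section positive_part.
Context (R : realType).

Definition pos_part (x : R) : R := Num.max x 0.

Lemma pos_part_cases x : x <= 0 /\ pos_part x = 0 \/ 0 <= x /\ pos_part x = x.
Proof.
by rewrite /pos_part; have [x0|x0] := leP x 0; [left|right; split => //; exact: ltW].
Qed.

Lemma pos_part_le0 x : x <= 0 -> pos_part x = 0.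
Proof. by move=> x0; rewrite /pos_part max_r. Qed.

Lemma pos_part_ge0 x : 0 <= x -> pos_part x = x.
Proof. by move=> x0; rewrite /pos_part max_l. Qed.
End positive_part.

Section extremal_copulas.
Context (R : realType).
Implicit Types (C : R -> R -> R) (d t u v : R).

Definition lower_copula d u v : R :=
  Num.max (Num.max 0 (u + v - 1)) (d - pos_part (1 / 2 - u) - pos_part (1 / 2 - v)).

Lemma lower_copula_cases d u v :
  [\/ lower_copula d u v = 0, lower_copula d u v = u + v - 1
  | lower_copula d u v = d - pos_part (1 / 2 - u) - pos_part (1 / 2 - v)].
Proof.
rewrite /lower_copula; case: leP => _; first exact: Or33.
by case: leP => _; [exact: Or32|exact: Or31].
Qed.

Lemma lower_copula_ge d u v :
  [/\ 0 <= lower_copula d u v, u + v - 1 <= lower_copula d u v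
  & d - pos_part (1 / 2 - u) - pos_part (1 / 2 - v) <= lower_copula d u v].
Proof. by rewrite /lower_copula !le_max !lexx ?orbT. Qed.

Lemma pos_part_half_lip u v : u <= v ->
  0 <= pos_part (1 / 2 - u) - pos_part (1 / 2 - v) <= v - u.
Proof.
move=> uv; case: (pos_part_cases (1 / 2 - u)) => -[? ->];
by case: (pos_part_cases (1 / 2 - v)) => -[? ->]; lra.
Qed.

(** Each of the corners [(u1, v2)] and [(u2, v1)] equals one of the three terms, and the other two
    corners dominate all of them. Each term is modular, and the increments of the three terms in
    either variable are ordered by [pos_part_half_lip], which settles the mixed cases. *)
Lemma lower_copula_supermodular d u1 u2 v1 v2 : u1 <= u2 -> v1 <= v2 ->
  0 <= rect_vol (lower_copula d) u1 u2 v1 v2.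
Proof.
move=> u12 v12; rewrite /rect_vol.
have [] := lower_copula_ge d u1 v1; have [] := lower_copula_ge d u2 v2.
have := lower_copula_cases d u1 v2; have := lower_copula_cases d u2 v1.
move: (lower_copula d u1 v1) (lower_copula d u1 v2) (lower_copula d u2 v1)
  (lower_copula d u2 v2).
have := pos_part_half_lip u12; have := pos_part_half_lip v12.
move: (pos_part _) (pos_part _) (pos_part _) (pos_part _) =>
  p1 p2 p3 p4 ? ? x11 x12 x21 x22.
by move=> [] -> [] -> ? ? ? ? ? ?; lra.
Qed.

Lemma lower_copula_0r d u : d <= 1 / 2 -> 0 <= u <= 1 -> lower_copula d u 0 = 0.
Proof.
move=> d2 u01; have [] := lower_copula_ge d u 0; have := lower_copula_cases d u 0.
case: (pos_part_cases (1 / 2 - 0 : R)) => -[? ->]; first by lra.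
by case: (pos_part_cases (1 / 2 - u)) => -[? ->] [] ->; lra.
Qed.

Lemma lower_copula_1r d u : 0 <= d <= 1 / 2 -> 0 <= u <= 1 -> lower_copula d u 1 = u.
Proof.
move=> d2 u01; have [] := lower_copula_ge d u 1; have := lower_copula_cases d u 1.
case: (pos_part_cases (1 / 2 - 1 : R)) => -[? ->]; last by lra.
by case: (pos_part_cases (1 / 2 - u)) => -[? ->] [] ->; lra.
Qed.

Lemma lower_copula_sym d u v : lower_copula d u v = lower_copula d v u.
Proof. by rewrite /lower_copula [u + v]addrC [d - _ - _]addrAC. Qed.

Lemma lower_copula_copula d : 0 <= d <= 1 / 2 -> is_copula (lower_copula d).
Proof.
move=> d01; have /andP[d0 d1] := d01; split.
- move=> u v u01 v01; have [] := lower_copula_ge d u v; have := lower_copula_cases d u v.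
  case: (pos_part_cases (1 / 2 - u)) => -[? ->];
    by case: (pos_part_cases (1 / 2 - v)) => -[? ->] [] ->; lra.
- by move=> u u01; rewrite lower_copula_0r// lower_copula_1r.
- by move=> v v01; rewrite lower_copula_sym lower_copula_0r// lower_copula_sym lower_copula_1r.
- by move=> u1 u2 v1 v2 _ u12 _ _ v12 _; exact: lower_copula_supermodular.
Qed.

Lemma lower_copula_half d : 0 <= d -> lower_copula d (1 / 2) (1 / 2) = d.
Proof.
move=> d0; have [] := lower_copula_ge d (1 / 2) (1 / 2).
have := lower_copula_cases d (1 / 2) (1 / 2).
by case: (pos_part_cases (1 / 2 - 1 / 2 : R)) => -[? ->] [] ->; lra.
Qed.

(** The first two terms come from positivity and from the volume of [[u, 1] x [v, 1]]. For the
    third, go from the centre to [(1/2, v)] and on to [(u, v)]: an upward move loses nothing, a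
    downward one at most its length. *)
Lemma lower_copula_le C u v : is_copula C -> 0 <= u <= 1 -> 0 <= v <= 1 ->
  lower_copula (C (1 / 2) (1 / 2)) u v <= C u v.
Proof.
move=> cC u01 v01; have [C01 C1 C2 C3] := cC.
have h01 : 0 <= (1 / 2 : R) <= 1 by lra.
case: (lower_copula_cases (C (1 / 2) (1 / 2)) u v) => ->.
- by have := C01 u v u01 v01; lra.
- have [_ E1] := C1 u u01; have [_ E2] := C2 v v01; have [_ E3] := C2 1 ltac:(lra).
  by have := C3 u 1 v 1 ltac:(lra) ltac:(lra) ltac:(lra) ltac:(lra) ltac:(lra)
    ltac:(lra); lra.
- have : C (1 / 2) v - pos_part (1 / 2 - u) <= C u v.
    case: (pos_part_cases (1 / 2 - u)) => -[? ->].
      by have := copula_le1 cC (u := 1 / 2) (u' := u) ltac:(lra) ltac:(lra) ltac:(lra) v01; lra.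
    by have := copula_le1 cC (u := u) (u' := 1 / 2) ltac:(lra) ltac:(lra) ltac:(lra) v01; lra.
  have : C (1 / 2) (1 / 2) - pos_part (1 / 2 - v) <= C (1 / 2) v.
    case: (pos_part_cases (1 / 2 - v)) => -[? ->].
      by have := copula_le2 cC (v := 1 / 2) (v' := v) ltac:(lra) ltac:(lra) ltac:(lra) h01; lra.
    by have := copula_le2 cC (v := v) (v' := 1 / 2) ltac:(lra) ltac:(lra) ltac:(lra) h01; lra.
  lra.
Qed.

(** The copula of [(U, 1 - V)] when [C] is that of [(U, V)]; an order-reversing involution. *)
Definition flip C u v : R := u - C u (1 - v).

Lemma flip_copula C : is_copula C -> is_copula (flip C).
Proof.
move=> cC; have [C01 C1 C2 C3] := cC; rewrite /flip; split.
- move=> u v u01 v01; have := C01 u (1 - v) u01 ltac:(lra); have [C0 _] := C1 u u01.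
  have [_ E] := C1 u u01.
  by have := copula_le2 cC (v := 1 - v) (v' := 1) (u := u) ltac:(lra) ltac:(lra) ltac:(lra) u01; lra.
- by move=> u u01; rewrite subr0 subrr; have [-> ->] := C1 u u01; lra.
- by move=> v v01; have [-> ->] := C2 (1 - v) ltac:(lra); lra.
- move=> u1 u2 v1 v2 ? ? ? ? ? ?.
  by have := C3 u1 u2 (1 - v2) (1 - v1) ltac:(lra) ltac:(lra) ltac:(lra) ltac:(lra) ltac:(lra)
    ltac:(lra); lra.
Qed.

Lemma eq_copula C C' :
  (forall u v, 0 <= u <= 1 -> 0 <= v <= 1 -> C u v = C' u v) ->
  is_copula C -> is_copula C'.
Proof.
move=> CC' [C01 C1 C2 C3].
have o0 : 0 <= (0 : R) <= 1 by lra.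
have o1 : 0 <= (1 : R) <= 1 by lra.
split.
- by move=> u v u01 v01; rewrite -CC'//; exact: C01.
- by move=> u u01; rewrite -!CC'//; exact: C1.
- by move=> u u01; rewrite -!CC'//; exact: C2.
- by move=> u1 u2 v1 v2 ? ? ? ? ? ?; rewrite -!CC'; [exact: C3|lra..].
Qed.

(** Monotonicity in both directions, which avoids comparing the measures chosen for [C] and [C']. It
    serves to replace the pointwise bounds by formulas valid on the unit square. *)
Lemma eq_spearman_rho C C' :
  (forall u v, 0 <= u <= 1 -> 0 <= v <= 1 -> C u v = C' u v) ->
  is_copula C -> spearman_rho C = spearman_rho C'.
Proof.
move=> CC' cC; have cC' := eq_copula CC' cC.
by apply/eqP; rewrite eq_le; apply/andP; split; apply: spearman_rho_le => // u v u01 v01;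
  rewrite CC'.
Qed.

Lemma beta_class_half t C :
  beta_class t C <-> is_copula C /\ C (1 / 2) (1 / 2) = (1 + t) / 4.
Proof.
rewrite /beta_class /blomqvist_beta /=; move: (C (1 / 2) (1 / 2)) => x.
by split=> -[cC h]; split => //; lra.
Qed.

Lemma beta_class_flip t C : beta_class t C -> beta_class (- t) (flip C).
Proof.
move=> /beta_class_half[cC Ct]; apply/beta_class_half; split; first exact: flip_copula.
have E : 1 - 1 / 2 = 1 / 2 :> R by lra.
by rewrite /flip E Ct; lra.
Qed.

Lemma beta_class_lower t : -1 <= t <= 1 -> beta_class t (lower_copula ((1 + t) / 4)).
Proof.
move=> ht; apply/beta_class_half; split; first by apply: lower_copula_copula; lra.
by apply: lower_copula_half; lra.
Qed.

(** The infimum is attained: the lower bound [lower_copula] itself belongs to the class. *)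
Lemma beta_lowerE t u v : -1 <= t <= 1 -> 0 <= u <= 1 -> 0 <= v <= 1 ->
  beta_lower t u v = lower_copula ((1 + t) / 4) u v.
Proof.
move=> ht u01 v01; have bm := beta_class_lower ht.
have lb : lbound [set C u v | C in beta_class t] (lower_copula ((1 + t) / 4) u v).
  by move=> _ [C /beta_class_half[cC Ct] <-]; rewrite -Ct; exact: lower_copula_le.
apply/eqP; rewrite eq_le; apply/andP; split.
  by apply: ge_inf; [exists (lower_copula ((1 + t) / 4) u v)|
    exists (lower_copula ((1 + t) / 4))].
by apply: lb_le_inf => //;
  exists (lower_copula ((1 + t) / 4) u v), (lower_copula ((1 + t) / 4)).
Qed.

Lemma beta_upperE t u v : -1 <= t <= 1 -> 0 <= u <= 1 -> 0 <= v <= 1 ->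
  beta_upper t u v = flip (lower_copula ((1 - t) / 4)) u v.
Proof.
move=> ht u01 v01.
have bm : beta_class t (flip (lower_copula ((1 - t) / 4))).
  rewrite -{1}[t]opprK; apply: beta_class_flip.
  by apply: beta_class_lower; lra.
have ub : ubound [set C u v | C in beta_class t]
    (flip (lower_copula ((1 - t) / 4)) u v).
  (* The lower bound for [flip C], taken at [(u, 1 - v)], is an upper bound for [C] at [(u, v)]. *)
  move=> _ [C bC <-]; have /beta_class_half[cC Ct] := beta_class_flip bC.
  have := lower_copula_le (u := u) (v := 1 - v) cC u01 ltac:(lra).
  have E : 1 - (1 - v) = v by lra.
  by rewrite Ct /flip E; lra.
apply/eqP; rewrite eq_le; apply/andP; split.
  by apply: ge_sup => //;
    exists (flip (lower_copula ((1 - t) / 4)) u v), (flip (lower_copula ((1 - t) / 4))).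
by apply: ub_le_sup; [exists (flip (lower_copula ((1 - t) / 4)) u v)|
  exists (flip (lower_copula ((1 - t) / 4)))].
Qed.
End extremal_copulas.

(** * Integrals over the unit interval *)

Section unit_integral.
Context (R : realType).
Notation mu := (@lebesgue_measure R).
Implicit Types (f g : R -> R) (a b c : R).

(** Integrability is kept together with the value, so that linearity has no side conditions. *)
Definition unit_integral f a : Prop :=
  mu.-integrable `[0, 1] (EFin \o f) /\
  (\int[mu]_(x in `[0%R, 1%R]) (f x)%:E = a%:E)%E.

Lemma eq_unit_integral g f a : (forall x, 0 <= x <= 1 -> f x = g x) ->
  unit_integral f a -> unit_integral g a.
Proof.
move=> fg [If fa]; split.
  apply: eq_integrable If => //= x; rewrite inE/= ?in_itv/= => x01.
  by rewrite fg.
by rewrite -fa; apply: eq_integral => x; rewrite inE/= ?in_itv/= => x01; rewrite fg.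
Qed.

Lemma unit_integralD f g a b : unit_integral f a -> unit_integral g b ->
  unit_integral (fun x => f x + g x) (a + b).
Proof.
move=> [If fa] [Ig gb].
have mI : measurable (`[0, 1] : set (measurableTypeR R)) by exact: measurable_itv.
split; first exact: (integrableD mI If Ig).
by under eq_integral do rewrite EFinD; rewrite integralD_EFin//= fa gb.
Qed.

Lemma unit_integralZ c f a :
  unit_integral f a -> unit_integral (fun x => c * f x) (c * a).
Proof.
move=> [If fa].
have mI : measurable (`[0, 1] : set (measurableTypeR R)) by exact: measurable_itv.
split; first exact: (integrableZl mI c If).
by under eq_integral do rewrite EFinM; rewrite integralZl//= fa.
Qed.

Lemma integral_FTC_to1 c (f F : R -> R) : 0 <= c <= 1 -> continuous f ->
  (forall x, is_derive x (1 : R) F (f x)) ->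
  (\int[mu]_(x in `[c, 1%R]) (f x)%:E = (F 1%R)%:E - (F c)%:E)%E.
Proof.
move=> /andP[c0 c1] cf dF; move: c1; rewrite le_eqVlt => /predU1P[->|c1].
  by rewrite subee// set_itv1 integral_set1.
have cF : continuous F.
  move=> x; apply/differentiable_continuous/derivable1_diffP.
  by have [] := dF x.
apply: continuous_FTC2 => //.
- exact: continuous_subspaceT.
- split.
  + by move=> x _; have [] := dF x.
  + exact: cvg_at_right_filter (cF c).
  + exact: cvg_at_left_filter (cF 1).
- by move=> x _; rewrite derive1E; have [_ ->] := dF x.
Qed.

Lemma integrable_unit f : continuous f -> mu.-integrable `[0, 1] (EFin \o f).
Proof.
move=> cf; apply: continuous_compact_integrable; first exact: segment_compact.
exact: continuous_subspaceT.
Qed.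

Lemma FTC_unit_integral (f F : R -> R) a : continuous f ->
  (forall x, is_derive x (1 : R) F (f x)) -> F 1 - F 0 = a -> unit_integral f a.
Proof.
move=> cf dF <-; split; first exact: integrable_unit.
by rewrite (@integral_FTC_to1 0 f F _ cf dF) ?EFinB ?lexx ?ler01.
Qed.

Lemma unit_integral_cst a : unit_integral (fun=> a) a.
Proof.
apply: (@FTC_unit_integral _ (fun x => a * x)) => [x|x|]; first exact: cvg_cst.
  by apply: is_derive_eq; rewrite /GRing.scale/=; lra.
by lra.
Qed.

Lemma unit_integral_id : unit_integral id (1 / 2).
Proof.
apply: (@FTC_unit_integral _ (fun x => 1 / 2 * x ^+ 2)) => [x|x|]; first exact: cvg_id.
  by apply: is_derive_eq; rewrite /GRing.scale/=; lra.
by lra.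
Qed.

Lemma unit_integral_sqr : unit_integral (fun x => x ^+ 2) (1 / 3).
Proof.
apply: (@FTC_unit_integral _ (fun x => 1 / 3 * x ^+ 3)) => [|x|].
- exact: exprn_continuous.
- by apply: is_derive_eq; rewrite /GRing.scale/=; lra.
- by lra.
Qed.

(** The integrand vanishes below [c], and on [[c, 1]] it has the antiderivative [(x - c)^2 / 2]. *)
Lemma unit_integral_pos c : 0 <= c <= 1 ->
  unit_integral (fun x => pos_part (x - c)) ((1 - c) ^+ 2 / 2).
Proof.
move=> c01.
have cf : continuous (fun x : R => x - c).
  by move=> x; apply: cvgB; [exact: cvg_id|exact: cvg_cst].
split.
  apply: integrable_unit => x.
  exact: (@continuous_max _ _ (fun x => x - c) (fun=> 0) x (cf x) (@cst_continuous _ _ 0 x)).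
have dF (x : R) : is_derive x (1 : R) (fun x => 1 / 2 * (x - c) ^+ 2) (x - c).
  by apply: is_derive_eq; rewrite /GRing.scale/=; lra.
have := integral_FTC_to1 c01 cf dF.
rewrite -EFinB subrr expr0n/= mulr0 subr0 mul1r mulrC => <-.
rewrite [LHS]integral_mkcond [RHS]integral_mkcond; apply: eq_integral => x _.
rewrite !patchE !mem_setE !in_itv/=.
have [xc|xc]/= := leP c x; have [x1|x1]/= := leP x 1; rewrite ?andbF ?andbT//.
- rewrite ifT; last by lra.
  by case: (pos_part_cases (x - c)) => -[? ->]; congr _%:E; lra.
- by case: ifP => // _; case: (pos_part_cases (x - c)) => -[? ->]; congr _%:E; lra.
Qed.

Lemma unit_integral_neg c : 0 <= c <= 1 ->
  unit_integral (fun x => pos_part (1 - x - c)) ((1 - c) ^+ 2 / 2).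
Proof.
move=> c01.
(* A number is its positive part minus that of its opposite; here the number is [1 - x - c]. *)
apply: (@eq_unit_integral _ (fun x => pos_part (x - (1 - c)) + (-1 * x + (1 - c)))).
  move=> x x01.
  by case: (pos_part_cases (1 - x - c)) => -[? ->];
    case: (pos_part_cases (x - (1 - c))) => -[? ->]; lra.
rewrite (_ : _ / 2 = (1 - (1 - c)) ^+ 2 / 2 + (-1 * (1 / 2) + (1 - c))); last by field.
apply: unit_integralD; first by apply: unit_integral_pos; lra.
by apply: unit_integralD; [exact/unit_integralZ/unit_integral_id|exact: unit_integral_cst].
Qed.
End unit_integral.

(** * Spearman's rho of the extremal copulas *)

Section spearman_rho_min.
Context (R : realType).
Variable d : R.

(* The integral of [v |-> lower_copula d u v] over the unit interval. *)
Definition section_integral (u : R) : R := 1 / 2 * u ^+ 2 +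
  d * (pos_part (u - (1 / 2 - d)) +
       (-2 * pos_part (u - 1 / 2) + pos_part (u - (1 / 2 + d)))).

(** For such [u] the third term is at most 0 on the left and never exceeds the other two on the
    right, so only [max(0, u + v - 1)] remains. *)
Lemma lower_copula_outer (u v : R) : u <= 1 / 2 - d \/ 1 / 2 + d <= u ->
  0 <= u <= 1 -> 0 <= v <= 1 -> lower_copula d u v = pos_part (v - (1 - u)).
Proof.
move=> ud u01 v01; have [] := lower_copula_ge d u v; have := lower_copula_cases d u v.
move: (lower_copula d u v) => m.
case: (pos_part_cases (1 / 2 - v)) => -[? ->]; case: (pos_part_cases (1 / 2 - u)) => -[? ->];
case: (pos_part_cases (v - (1 - u))) => -[? ->];
  by move=> [] ->; case: ud; lra.
Qed.

(** In [v], the third term becomes positive at [1 - d - u], grows with slope 1 up to [1/2] and stays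
    flat until [u + v - 1] overtakes it at [1/2 + d]. *)
Lemma lower_copula_left (u v : R) : 1 / 2 - d <= u <= 1 / 2 -> 0 <= v <= 1 ->
  lower_copula d u v = pos_part (v - (1 - d - u)) +
    (-1 * pos_part (v - 1 / 2) + pos_part (v - (1 / 2 + d))).
Proof.
move=> ud v01; have [] := lower_copula_ge d u v; have := lower_copula_cases d u v.
rewrite (@pos_part_ge0 _ (1 / 2 - u)); last by lra.
move: (lower_copula d u v) => m.
have [v1|v1] := leP v (1 - d - u).
  rewrite !(@pos_part_le0 _ (v - _)); [|lra..].
  by rewrite pos_part_ge0; [move=> [] ->; lra|lra].
rewrite (@pos_part_ge0 _ (v - (1 - d - u))); last by lra.
have [v2|v2] := leP v (1 / 2).
  rewrite !(@pos_part_le0 _ (v - _)); [|lra..].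
  by rewrite pos_part_ge0; [move=> [] ->; lra|lra].
rewrite (@pos_part_ge0 _ (v - 1 / 2)); last by lra.
rewrite (@pos_part_le0 _ (1 / 2 - v)); last by lra.
by case: (pos_part_cases (v - (1 / 2 + d))) => -[? ->] [] ->; lra.
Qed.

(** The same shape in [v]: the rise starts at [1/2 - d], and [u + v - 1] takes over at
    [1 + d - u]. *)
Lemma lower_copula_right (u v : R) : 1 / 2 <= u <= 1 / 2 + d -> 0 <= v <= 1 ->
  lower_copula d u v = pos_part (v - (1 / 2 - d)) +
    (-1 * pos_part (v - 1 / 2) + pos_part (v - (1 + d - u))).
Proof.
move=> ud v01; have [] := lower_copula_ge d u v; have := lower_copula_cases d u v.
rewrite (@pos_part_le0 _ (1 / 2 - u)); last by lra.
move: (lower_copula d u v) => m.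
have [v1|v1] := leP v (1 / 2 - d).
  rewrite !(@pos_part_le0 _ (v - _)); [|lra..].
  by rewrite pos_part_ge0; [move=> [] ->; lra|lra].
rewrite (@pos_part_ge0 _ (v - (1 / 2 - d))); last by lra.
have [v2|v2] := leP v (1 / 2).
  rewrite !(@pos_part_le0 _ (v - _)); [|lra..].
  by rewrite pos_part_ge0; [move=> [] ->; lra|lra].
rewrite (@pos_part_ge0 _ (v - 1 / 2)); last by lra.
rewrite (@pos_part_le0 _ (1 / 2 - v)); last by lra.
by case: (pos_part_cases (v - (1 + d - u))) => -[? ->] [] ->; lra.
Qed.

(** One form with three kinks for every [u], to be integrated termwise in [v] and, for the flipped
    copula, in [1 - v]. *)
Lemma lower_copula_section (u : R) : 0 <= d <= 1 / 2 -> 0 <= u <= 1 -> exists a b c : R,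
  [/\ 0 <= a <= 1, 0 <= b <= 1, 0 <= c <= 1,
    forall v, 0 <= v <= 1 ->
      lower_copula d u v = pos_part (v - a) + (-1 * pos_part (v - b) + pos_part (v - c))
  & section_integral u =
      (1 - a) ^+ 2 / 2 + (-1 * ((1 - b) ^+ 2 / 2) + (1 - c) ^+ 2 / 2)].
Proof.
move=> d01 u01; rewrite /section_integral.
have outer : u <= 1 / 2 - d \/ 1 / 2 + d <= u -> forall v, 0 <= v <= 1 ->
    lower_copula d u v = pos_part (v - (1 - u)) + (-1 * pos_part (v - 1) + pos_part (v - 1)).
  by move=> ud v v01; rewrite lower_copula_outer//; lra.
have [u1|u1] := leP u (1 / 2 - d).
  (* There is a single kink at [1 - u]; the other two are put at 1, where they cancel. *)
  exists (1 - u), 1, 1; split; [lra|lra|lra|by apply: outer; left|].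
  rewrite (@pos_part_le0 _ (u - (1 / 2 - d))); last by lra.
  rewrite (@pos_part_le0 _ (u - 1 / 2)); last by lra.
  by rewrite (@pos_part_le0 _ (u - (1 / 2 + d))); [field|lra].
rewrite (@pos_part_ge0 _ (u - (1 / 2 - d))); last by lra.
have [u2|u2] := leP u (1 / 2).
  exists (1 - d - u), (1 / 2), (1 / 2 + d); split; [lra|lra|lra| |].
    by move=> v v01; apply: lower_copula_left => //; lra.
  rewrite (@pos_part_le0 _ (u - 1 / 2)); last by lra.
  by rewrite (@pos_part_le0 _ (u - (1 / 2 + d))); [field|lra].
rewrite (@pos_part_ge0 _ (u - 1 / 2)); last by lra.
have [u3|u3] := leP u (1 / 2 + d).
  exists (1 / 2 - d), (1 / 2), (1 + d - u); split; [lra|lra|lra| |].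
    by move=> v v01; apply: lower_copula_right => //; lra.
  by rewrite (@pos_part_le0 _ (u - (1 / 2 + d))); [field|lra].
exists (1 - u), 1, 1; split; [lra|lra|lra|by apply: outer; right; lra|].
by rewrite (@pos_part_ge0 _ (u - (1 / 2 + d))); [field|lra].
Qed.

Lemma lower_copula_unit_integral (u : R) : 0 <= d <= 1 / 2 -> 0 <= u <= 1 ->
  unit_integral (lower_copula d u) (section_integral u) /\
  unit_integral (fun v => lower_copula d u (1 - v)) (section_integral u).
Proof.
move=> d01 /(lower_copula_section d01)[a [b [c [a01 b01 c01 E ->]]]]; split.
  apply: eq_unit_integral => [v v01|]; first by symmetry; exact: E.
  by apply: unit_integralD; [exact: unit_integral_pos|apply: unit_integralD;
    [apply: unit_integralZ|]; exact: unit_integral_pos].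
apply: eq_unit_integral => [v v01|]; first by symmetry; apply: E; lra.
by apply: unit_integralD; [exact: unit_integral_neg|apply: unit_integralD;
  [apply: unit_integralZ|]; exact: unit_integral_neg].
Qed.

(** The factor of [d] in [section_integral] is a tent of height [d] over [[1/2 - d, 1/2 + d]], of
    area [d^2]; the square contributes [1/6]. *)
Lemma section_integral_unit_integral : 0 <= d <= 1 / 2 ->
  unit_integral section_integral (1 / 6 + d ^+ 3).
Proof.
move=> d01.
rewrite (_ : 1 / 6 + d ^+ 3 = 1 / 2 * (1 / 3) + d * ((1 - (1 / 2 - d)) ^+ 2 / 2 +
  (-2 * ((1 - 1 / 2) ^+ 2 / 2) + (1 - (1 / 2 + d)) ^+ 2 / 2))); last by field.
apply: unit_integralD; first exact/unit_integralZ/unit_integral_sqr.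
apply/unit_integralZ/unit_integralD; first by apply: unit_integral_pos; lra.
by apply: unit_integralD; [apply: unit_integralZ|]; apply: unit_integral_pos; lra.
Qed.

Lemma spearman_rho_survival (C : R -> R -> R) (h : R -> R) (a : R) : is_copula C ->
  (forall s, 0 <= s <= 1 -> unit_integral (fun t => survival C (s, t)) (h s)) ->
  unit_integral h a -> spearman_rho C = 12 * a - 3.
Proof.
move=> cC Ch ha; rewrite spearman_rhoE// (@survival_integral _ _ cC h).
  by case: ha => _ ->.
by move=> s s01; case: (Ch s s01).
Qed.

Lemma spearman_rho_lower_copula : 0 <= d <= 1 / 2 ->
  spearman_rho (lower_copula d) = 12 * d ^+ 3 - 1.
Proof.
move=> d01.
(* Integrating [1 - s - t] over [t] leaves [1/2 - s]. *)
rewrite (@spearman_rho_survival _ (fun s => 1 / 2 + (-1 * s + section_integral s))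
  (1 / 2 + (-1 * (1 / 2) + (1 / 6 + d ^+ 3)))); first by field.
- exact: lower_copula_copula.
- move=> s s01.
  apply: (@eq_unit_integral _ _ (fun t => (1 - s) + (-1 * t + lower_copula d s t))).
    by move=> t _; rewrite /survival/=; lra.
  rewrite (_ : 1 / 2 + (-1 * s + section_integral s) =
    (1 - s) + (-1 * (1 / 2) + section_integral s)); last by lra.
  apply: unit_integralD; first exact: unit_integral_cst.
  apply: unit_integralD; first exact/unit_integralZ/unit_integral_id.
  by have [] := lower_copula_unit_integral d01 s01.
- apply: unit_integralD; first exact: unit_integral_cst.
  apply: unit_integralD; first exact/unit_integralZ/unit_integral_id.
  exact: section_integral_unit_integral.
Qed.

Lemma spearman_rho_flip_lower_copula : 0 <= d <= 1 / 2 ->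
  spearman_rho (flip (lower_copula d)) = 1 - 12 * d ^+ 3.
Proof.
move=> d01.
(* In the survival function of the flip [s] cancels, which leaves
   [1 - t - lower_copula d s (1 - t)]. *)
rewrite (@spearman_rho_survival _ (fun s => 1 / 2 + -1 * section_integral s)
  (1 / 2 + -1 * (1 / 6 + d ^+ 3))); first by field.
- exact/flip_copula/lower_copula_copula.
- move=> s s01.
  apply: (@eq_unit_integral _ _ (fun t => 1 + (-1 * t + -1 * lower_copula d s (1 - t)))).
    by move=> t _; rewrite /survival/flip/=; lra.
  rewrite (_ : 1 / 2 + -1 * section_integral s =
    1 + (-1 * (1 / 2) + -1 * section_integral s)); last by lra.
  apply: unit_integralD; first exact: unit_integral_cst.
  apply: unit_integralD; first exact/unit_integralZ/unit_integral_id.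
  by apply: unit_integralZ; have [] := lower_copula_unit_integral d01 s01.
- apply: unit_integralD; first exact: unit_integral_cst.
  exact/unit_integralZ/section_integral_unit_integral.
Qed.
End spearman_rho_min.

Theorem theorem3 (R : realType) (t : R) (ht : -1 <= t <= 1) :
  [/\ forall C : R -> R -> R, beta_class t C ->
        spearman_rho (beta_lower t) <= spearman_rho C <=
        spearman_rho (beta_upper t),
      spearman_rho (beta_lower t) = 3 / 16 * (1 + t) ^+ 3 - 1
    & spearman_rho (beta_upper t) = 1 - 3 / 16 * (1 - t) ^+ 3].
Proof.
have dl : 0 <= (1 + t) / 4 <= 1 / 2 by lra.
have du : 0 <= (1 - t) / 4 <= 1 / 2 by lra.
have cl := lower_copula_copula dl; have cu := flip_copula (lower_copula_copula du).
have -> : spearman_rho (beta_lower t) = spearman_rho (lower_copula ((1 + t) / 4)).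
  by apply/esym/eq_spearman_rho => // u v u01 v01; rewrite beta_lowerE.
have -> : spearman_rho (beta_upper t) = spearman_rho (flip (lower_copula ((1 - t) / 4))).
  by apply/esym/eq_spearman_rho => // u v u01 v01; rewrite beta_upperE.
split.
- move=> C bC; have [cC Ct] := (beta_class_half t C).1 bC.
  apply/andP; split; apply: spearman_rho_le => // u v u01 v01.
    by rewrite -Ct; exact: lower_copula_le.
  (* The upper bound is the lower bound for the flip of [C], read at [(u, 1 - v)]. *)
  have [cfC fCt] := (beta_class_half _ _).1 (beta_class_flip bC).
  have v'01 : 0 <= 1 - v <= 1 by lra.
  have := lower_copula_le cfC u01 v'01; rewrite fCt /flip.
  have -> : 1 - (1 - v) = v by lra.
  by lra.
(* With [d = (1 + t) / 4] the factor 12 becomes [12 / 64 = 3 / 16]. *)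
- by rewrite spearman_rho_lower_copula//; field.
- by rewrite spearman_rho_flip_lower_copula//; field.
Qed.
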